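(* Let $\mathscr{A}\in\mathbb{C}^{n\times n\times p}$. If $[\rho_T(\mathscr{A})]\prec[e_1]$, then $\lim_{k\to\infty}\mathscr{A}^k=\mathscr{O}$, where $\mathscr{A}^k=\mathscr{A}*\mathscr{A}*\cdots*\mathscr{A}$ ($k$ times) and $\mathscr{O}$ is the zero tensor.
   Context: For a tensor $\mathscr{X}\in\mathbb{C}^{n\times m\times p}$, $X_k\in\mathbb{C}^{n\times m}$ denotes the $k$-th frontal slice. $\mathrm{Unfold}(\mathscr{X})\in\mathbb{C}^{np\times m}$ stacks $X_1,\dots,X_p$ vertically, and $\mathrm{Fold}$ is its inverse. $\mathrm{bcirc}(\mathscr{X})\in\mathbb{C}^{np\times mp}$ is the block-circulant matrix whose $(i,j)$ block is $X_{((i-j)\bmod p)+1}$. The T-product of $\mathscr{X}\in\mathbb{C}^{n\times m\times p}$ and $\mathscr{Y}\in\mathbb{C}^{m\times\ell\times p}$ is $\mathscr{X}*\mathscr{Y}=\mathrm{Fold}(\mathrm{bcirc}(\mathscr{X})\,\mathrm{Unfold}(\mathscr{Y}))$. The conjugate transpose $\mathscr{X}^H$ is the tensor with $\mathrm{bcirc}(\mathscr{X}^H)=\mathrm{bcirc}(\mathscr{X})^H$; $\mathscr{A}$ is Hermitian if $\mathscr{A}^H=\mathscr{A}$. A tubular tensor of length $p$ is a $1\times1\times p$ tensor; $[v]$ is the one with $[v]_{11j}=v_j$ ($v\in\mathbb{C}^p$), and $\mathrm{circ}([v])$ is the circulant matrix with $(i,j)$ entry $v_{((i-j)\bmod p)+1}$.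 $e_1=(1,0,\dots,0)^T\in\mathbb{C}^p$, so $[e_1]$ is the identity tubular tensor. A tensor is non-singular if its $\mathrm{bcirc}$ is non-singular. $F_p$ is the unitary DFT matrix with entries $p^{-1/2}\omega^{(j-1)(k-1)}$, $\omega=e^{-2\pi\mathbf{i}/p}$. Order: $\mathscr{A}\in\mathbb{C}^{n\times n\times p}$ is positive (semi)definite if the first frontal slice of $\mathscr{X}^H*\mathscr{A}*\mathscr{X}$ (a scalar) is $>0$ ($\ge0$) for all nonzero $\mathscr{X}\in\mathbb{C}^{n\times1\times p}$. For Hermitian $\mathscr{A},\mathscr{B}$, $\mathscr{A}\succ\mathscr{B}$ ($\mathscr{A}\succeq\mathscr{B}$) means $\mathscr{A}-\mathscr{B}$ is positive definite (semidefinite); $\prec,\preceq$ are analogous. This applies in particular to tubular tensors ($n=1$). For a Hermitian positive semidefinite tubular tensor $[v]$ with $\mathrm{circ}([v])=F_p\,\mathrm{diag}(d_1,\dots,d_p)F_p^H$, $[v]^{1/2}$ is the tubular tensor with $\mathrm{circ}([v]^{1/2})=F_p\,\mathrm{diag}(\sqrt{d_1},\dots,\sqrt{d_p})F_p^H$. Tubular eigenvalue: $[\lambda]$ is a tubular eigenvalue of $\mathscr{A}$ if there is $\mathscr{X}\in\mathbb{C}^{n\times1\times p}$ with $\mathscr{A}*\mathscr{X}=\mathscr{X}*[\lambda]$ and $\mathscr{X}^H*\mathscr{X}$ non-singular; $\sigma_T(\mathscr{A})$ is the set of tubular eigenvalues. Tubular spectral radius: $[\rho_T(\mathscr{A})]=([\mu]^H*[\mu])^{1/2}$,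 where $[\mu]\in\sigma_T(\mathscr{A})$ satisfies $[\mu]^H*[\mu]\succeq[\lambda]^H*[\lambda]$ for all $[\lambda]\in\sigma_T(\mathscr{A})$ (such $[\mu]$ exists, and the value does not depend on its choice). *)

(* Defs.v *)
From HB Require Import structures.
From mathcomp Require Import all_boot all_order all_algebra.
From mathcomp Require Import complex.
From mathcomp Require Import all_classical all_reals all_analysis.

Set Implicit Arguments.
Unset Strict Implicit.
Unset Printing Implicit Defensive.

Import Order.TTheory GRing.Theory Num.Theory.
Import numFieldNormedType.Exports.

Local Open Scope classical_set_scope.
Local Open Scope complex_scope.
Local Open Scope sesquilinear_scope.
Local Open Scope ring_scope.

(* The complex numbers are R[i] with R : realType; in its order, 0 <= z (0 < z)
   means that z is a nonnegative (positive) real. *)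

(* X k is the frontal slice of index k. Slices are numbered from 0 instead of 1.
   Below, the number of slices is written p.+1, so that index arithmetic in
   'I_p.+1 is arithmetic modulo the number of slices. *)
Definition tensor (R : realType) (n m p : nat) : Type :=
  {ffun 'I_p -> 'M[R[i]]_(n, m)}.

Section TProduct.
Variables (R : realType) (p : nat).
Implicit Types n m l : nat.

Definition tunfold n m (X : tensor R n m p.+1) :
  'M[R[i]]_(\sum_(k < p.+1) n, m) := \mxcol_(k < p.+1) X k.

Definition tfold n m (M : 'M[R[i]]_(\sum_(k < p.+1) n, m)) :
  tensor R n m p.+1 := [ffun k => submxcol M k].

Definition bcirc n m (X : tensor R n m p.+1) :
  'M[R[i]]_(\sum_(i < p.+1) n, \sum_(j < p.+1) m) :=
  \mxblock_(i < p.+1, j < p.+1) X (i - j).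

Definition tmul n m l (X : tensor R n m p.+1) (Y : tensor R m l p.+1) :
  tensor R n l p.+1 := tfold (bcirc X *m tunfold Y).

Definition tid n : tensor R n n p.+1 :=
  [ffun k => if k == 0 then 1%:M else 0].

Definition tpow n (A : tensor R n n p.+1) (k : nat) : tensor R n n p.+1 :=
  iter k (tmul A) (tid n).

(* The unique tensor whose bcirc is the conjugate transpose of bcirc X, by
   bcirc_ctrans and bcirc_inj below. *)
Definition ctrans n m (X : tensor R n m p.+1) : tensor R m n p.+1 :=
  [ffun k => (X (- k))^t*].

Definition thermitian n (A : tensor R n n p.+1) : Prop := ctrans A = A.

Definition tnonsingular n (A : tensor R n n p.+1) : Prop :=
  bcirc A \in unitmx.

Definition tposdef n (A : tensor R n n p.+1) : Prop :=
  forall X : tensor R n 1 p.+1, X != 0 ->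
    0 < tmul (tmul (ctrans X) A) X 0 0 0.

Definition tpossemidef n (A : tensor R n n p.+1) : Prop :=
  forall X : tensor R n 1 p.+1, X != 0 ->
    0 <= tmul (tmul (ctrans X) A) X 0 0 0.

Definition tlt n (A B : tensor R n n p.+1) : Prop :=
  [/\ thermitian A, thermitian B & tposdef (B - A)].

Definition tle n (A B : tensor R n n p.+1) : Prop :=
  [/\ thermitian A, thermitian B & tpossemidef (B - A)].

Definition tube (v : 'cV[R[i]]_p.+1) : tensor R 1 1 p.+1 :=
  [ffun k => (v k 0)%:M].

Definition circ (t : tensor R 1 1 p.+1) : 'M[R[i]]_p.+1 :=
  \matrix_(i, j) t (i - j) 0 0.

Definition omega : R[i] :=
  let theta := 2 * pi / p.+1%:R in cos theta -i* sin theta.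

Definition dft : 'M[R[i]]_p.+1 :=
  \matrix_(j, k) ((Num.sqrt p.+1%:R)^-1%:C * omega ^+ (j * k)).

(* w = v^{1/2}; the first equation with d >= 0 forces v to be Hermitian
   positive semidefinite. *)
Definition is_tsqrt (v w : tensor R 1 1 p.+1) : Prop :=
  exists d : 'rV[R]_p.+1,
    [/\ forall j, 0 <= d 0 j,
        circ v = dft *m diag_mx (\row_j (d 0 j)%:C) *m dft^t* &
        circ w = dft *m diag_mx (\row_j (Num.sqrt (d 0 j))%:C) *m dft^t*].

Definition tubular_spectrum n (A : tensor R n n p.+1) :
  set (tensor R 1 1 p.+1) :=
  [set lam | exists X : tensor R n 1 p.+1,
     tmul A X = tmul X lam /\ tnonsingular (tmul (ctrans X) X)].

(* The tubular spectral radius is given by its defining property, which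
   determines it uniquely and is satisfiable as soon as n > 0. *)
Definition is_tubular_spectral_radius n (A : tensor R n n p.+1)
    (rho : tensor R 1 1 p.+1) : Prop :=
  exists mu : tensor R 1 1 p.+1,
    [/\ tubular_spectrum A mu,
        forall lam, tubular_spectrum A lam ->
          tle (tmul (ctrans lam) lam) (tmul (ctrans mu) mu) &
        is_tsqrt (tmul (ctrans mu) mu) rho].

(* Entrywise convergence; MathComp-Analysis puts the modulus topology of the
   complex numbers on the alias R[i]^o of R[i]. *)
Definition tensor_cvg n m (X : nat -> tensor R n m p.+1)
    (L : tensor R n m p.+1) : Prop :=
  forall (s : 'I_p.+1) (i : 'I_n) (j : 'I_m),
    (fun k => X k s i j : R[i]^o) @ \oo --> (L s i j : R[i]^o).

Lemma bcirc_ctrans n m (X : tensor R n m p.+1) :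
  bcirc (ctrans X) = (bcirc X)^t*.
Proof.
apply/matrixP => i j; rewrite !mxE.
by rewrite ffunE mxE mxE opprB.
Qed.

Lemma bcirc_inj n m : injective (@bcirc n m).
Proof.
rewrite /bcirc => X Y /eq_mxblockP XY; apply/ffunP => k.
by have := XY k 0; rewrite subr0.
Qed.

End TProduct.

(* Main.v *)
Require Import Defs.
From HB Require Import structures.
From mathcomp Require Import all_boot all_order all_algebra.
From mathcomp Require Import complex.
From mathcomp Require Import all_classical all_reals all_analysis.
From mathcomp Require Import ring lra.

Set Implicit Arguments.
Unset Strict Implicit.
Unset Printing Implicit Defensive.

Import Order.TTheory GRing.Theory Num.Theory.
Import numFieldNormedType.Exports.

Local Open Scope classical_set_scope.
Local Open Scope sesquilinear_scope.
Local Open Scope ring_scope.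

(** The discrete Fourier transform along the third dimension turns a tensor
  [A] into a family of matrices [tdft A j], one for each character [j] of the
  cyclic group of indices. It is invertible, sends the T-product to the
  slicewise matrix product ([tdft_tmul]) and the conjugate transpose of
  tensors to that of matrices ([tdft_ctrans]). All the notions involved
  decouple in the Fourier domain.

  - The transform of a tubular tensor is a family of complex numbers, and the
    tensor is non-singular iff none of them vanishes ([tnonsingularP]). Hence
    [lam] is a tubular eigenvalue of [A] iff, for every [j], the number
    [tdft lam j 0 0] is an eigenvalue of [tdft A j] ([tubular_spectrumP]):
    eigenvalues may be chosen independently for each [j].
  - The order of Hermitian tubular tensors implies the componentwise order of
    their transforms ([tposdef_tdft], [tpossemidef_tdft]), as one sees by
    testing the quadratic form on the characters.

  Let [mu] realise the spectral radius [rho] and let [z] be an eigenvalue of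
  [tdft A j]. Replacing the [j]-th component of [mu] by [z] gives another
  tubular eigenvalue, so that [`|z| ^+ 2 <= (tdft rho j 0 0) ^+ 2 < 1]
  ([tdft_eigenvalue_lt1]). Therefore every [tdft A j] has its eigenvalues in
  the open unit disc and its powers tend to [0] ([cvg0_mxpow]); the slices of
  [tpow A k] are fixed linear combinations of the matrices [tdft A j ^+ k].

  For the powers of a matrix [M], no normal form is needed. By Cayley-Hamilton
  a product of factors [M - z%:M] with [`|z| < 1] is zero; these factors are
  peeled off one at a time, since the entries of [M ^+ k * N] satisfy the
  affine recursion [a k.+1 = z * a k + b k] where [b] is the corresponding
  entry of [M ^+ k * (M - z%:M) * N] ([cvg0_affine_recursion]). *)

(** * Characters of the cyclic group *)

Section RootOfUnity.
Variables (R : realType) (p : nat).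
Implicit Types j k l : 'I_p.+1.

Local Notation theta := (2 * pi / p.+1%:R : R).

(** De Moivre's formula. *)
Lemma omegaX m :
  omega R p ^+ m = Complex (cos (m%:R * theta)) (- sin (m%:R * theta)).
Proof.
elim: m => [|m IHm]; first by rewrite mul0r cos0 sin0 oppr0.
rewrite exprSr IHm -[m.+1]addn1 natrD (mulrDl _ _ theta) mul1r.
rewrite cosD sinD /omega.
by apply/eqP; rewrite eq_complex /=; apply/andP; split; apply/eqP; ring.
Qed.

Lemma omega_normed : omega R p * (omega R p)^* = 1.
Proof.
by rewrite -sqr_normc -add_Re2_Im2 /omega /= sqrrN cos2Dsin2.
Qed.

Lemma omega_order : omega R p ^+ p.+1 = 1.
Proof.
rewrite omegaX mulrCA mulfV ?pnatr_eq0// mulr1 mulrC mulr_natr.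
by rewrite cos2pi sin2pi oppr0.
Qed.

(** [omega] is a primitive root of unity: with [y = m pi / p.+1] the real part
  of its [m]-th power is [cos (2 y)], and [cos (2 y) = 1] would force
  [sin y = 0], whereas [0 < y < pi]. *)
Lemma omegaX_neq1 m : (0 < m < p.+1)%N -> omega R p ^+ m != 1.
Proof.
move=> /andP[m_gt0 m_lt]; rewrite omegaX; apply/negP => /eqP[cos1 _].
pose y : R := m%:R * pi / p.+1%:R.
have y_itv : 0 < y < pi.
  rewrite divr_gt0 ?mulr_gt0 ?pi_gt0 ?ltr0n//= ltr_pdivrMr ?ltr0n// mulrC.
  by rewrite ltr_pM2l ?pi_gt0// ltr_nat.
have := sin_gt0_pi y_itv; have := cos2Dsin2 y.
have : cos (y *+ 2) = 1.
  by rewrite -cos1; congr cos; rewrite -mulr_natr /y; ring.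
rewrite cos_mulr2n => cy sy s0.
have : 0 < sin y ^+ 2 by rewrite exprn_gt0.
lra.
Qed.

(** The [j]-th character [k |-> omega ^ (j k)] of the additive group
  ['I_p.+1] of integers modulo [p.+1]. *)
Definition wave j k : R[i] := omega R p ^+ (j * k).

Lemma waveC j k : wave j k = wave k j.
Proof. by rewrite /wave mulnC. Qed.

Lemma wave0 j : wave j 0 = 1.
Proof. by rewrite /wave muln0. Qed.

Lemma waveD j k l : wave j (k + l) = wave j k * wave j l.
Proof.
have wj1 : (omega R p ^+ j) ^+ p.+1 = 1.
  by rewrite -exprM mulnC exprM omega_order expr1n.
by rewrite /wave -exprD -mulnDr !(exprM _ j) -(expr_mod (k + l) wj1).
Qed.

Lemma wave_normed j k : wave j k * (wave j k)^* = 1.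
Proof. by rewrite /wave rmorphXn -exprMn omega_normed expr1n. Qed.

Lemma waveN j k : wave j (- k) = (wave j k)^*.
Proof.
rewrite -[LHS]mulr1 -(wave_normed j k) mulrA -waveD addNr wave0.
by rewrite mul1r.
Qed.

Lemma waveB j k l : wave j (k - l) = wave j k * (wave j l)^*.
Proof. by rewrite waveD waveN. Qed.

(** Orthogonality of the characters. *)
Lemma sum_wave j : \sum_k wave j k = (p.+1 * (j == 0))%:R.
Proof.
have [->|j_neq0] := eqVneq j 0.
  by rewrite muln1 (eq_bigr (fun=> 1)) ?sumr_const ?card_ord.
have jX_neq1 : omega R p ^+ j != 1.
  by apply: omegaX_neq1; rewrite ltn_ord lt0n andbT.
apply/eqP; rewrite muln0 -(mulrI_eq0 _ (x := omega R p ^+ j - 1)); last first.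
  by apply: mulfI; rewrite subr_eq0.
rewrite (eq_bigr (fun k : 'I_p.+1 => (omega R p ^+ j) ^+ k)).
  by rewrite -subrX1 -exprM mulnC exprM omega_order expr1n subrr.
by move=> k _; rewrite /wave exprM.
Qed.

End RootOfUnity.

(** * The discrete Fourier transform of a tensor *)

Section Fourier.
Variables (R : realType) (p : nat).
Implicit Types (j k : 'I_p.+1) (n m l : nat).

Local Notation wave := (@wave R p).

(** The unnormalised Fourier transform along the third dimension. *)
Definition tdft n m (X : tensor R n m p.+1) j : 'M[R[i]]_(n, m) :=
  \sum_k (wave j k)^* *: X k.

(** The inverse transform, which carries the normalising factor. *)
Definition tidft n m (D : 'I_p.+1 -> 'M[R[i]]_(n, m)) : tensor R n m p.+1 :=
  [ffun k => p.+1%:R^-1 *: \sum_j wave j k *: D j].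

Lemma tidftK n m (D : 'I_p.+1 -> 'M[R[i]]_(n, m)) j :
  tdft (tidft D) j = D j.
Proof.
rewrite /tdft; under eq_bigr => k _.
  rewrite ffunE scalerA mulrC -scalerA scaler_sumr.
  under eq_bigr => l _.
    rewrite scalerA mulrC waveC (waveC R j) -waveB waveC; over.
  over.
rewrite -scaler_sumr exchange_big/=.
under eq_bigr => l _ do rewrite -scaler_suml sum_wave subr_eq0.
rewrite (bigD1 j)//= eqxx muln1 big1 => [|l /negPf->]; last first.
  by rewrite muln0 scale0r.
by rewrite addr0 scalerA mulVf ?scale1r// pnatr_eq0.
Qed.

Lemma tdftK n m (X : tensor R n m p.+1) : tidft (tdft X) = X.
Proof.
apply/ffunP => k; rewrite ffunE.
under eq_bigr => j _.
  rewrite scaler_sumr; under eq_bigr => l _ do rewrite scalerA -waveB waveC.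
  over.
rewrite exchange_big/=.
under eq_bigr => l _ do rewrite -scaler_suml sum_wave subr_eq0 eq_sym.
rewrite (bigD1 k)//= eqxx muln1 big1 => [|l /negPf->]; last first.
  by rewrite muln0 scale0r.
by rewrite addr0 scalerA mulVf ?scale1r// pnatr_eq0.
Qed.

Lemma tdft_inj n m (X Y : tensor R n m p.+1) : tdft X =1 tdft Y -> X = Y.
Proof. by move=> /funext eXY; rewrite -[X]tdftK eXY tdftK. Qed.

Lemma tmulE n m l (X : tensor R n m p.+1) (Y : tensor R m l p.+1) k :
  tmul X Y k = \sum_j X (k - j) *m Y j.
Proof. by rewrite ffunE /bcirc /tunfold mul_mxblock_mxrow mxcolK. Qed.

Lemma tdft_tmul n m l (X : tensor R n m p.+1) (Y : tensor R m l p.+1) j :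
  tdft (tmul X Y) j = tdft X j *m tdft Y j.
Proof.
rewrite /tdft; under eq_bigr => k _ do rewrite tmulE scaler_sumr.
rewrite exchange_big mulmx_sumr; apply: eq_bigr => i _.
rewrite mulmx_suml (reindex_inj (addIr i)); apply: eq_bigr => k _.
by rewrite addrK waveD rmorphM -scalemxAl -scalemxAr scalerA.
Qed.

Lemma tdftB n m (X Y : tensor R n m p.+1) j :
  tdft (X - Y) j = tdft X j - tdft Y j.
Proof. by rewrite -sumrB; apply: eq_bigr => k _; rewrite !ffunE scalerBr. Qed.

Lemma tdft0 n m j : tdft (0 : tensor R n m p.+1) j = 0.
Proof. by rewrite /tdft big1// => k _; rewrite ffunE scaler0. Qed.

Lemma tdft_ctrans n m (X : tensor R n m p.+1) j :
  tdft (ctrans X) j = (tdft X j)^t*.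
Proof.
rewrite /tdft (reindex_inj oppr_inj) linear_sum map_mx_sum.
apply: eq_bigr => k _.
by rewrite ffunE opprK waveN linearZ map_mxZ.
Qed.

Lemma tdft_tid n j : tdft (tid R p n) j = 1%:M.
Proof.
rewrite /tdft (bigD1 0)//= big1 => [|k /negPf k0]; rewrite ffunE ?k0 ?scaler0//.
by rewrite eqxx wave0 conjC1 scale1r addr0.
Qed.

Lemma tdft_tpow n (A : tensor R n n p.+1) m j :
  tdft (tpow A m) j = tdft A j ^+ m.
Proof.
elim: m => [|m IHm]; first exact: tdft_tid.
by rewrite exprS [LHS]tdft_tmul IHm.
Qed.

(** The first frontal slice is the average of the Fourier components. *)
Lemma slice0E n m (X : tensor R n m p.+1) :
  X 0 = p.+1%:R^-1 *: \sum_j tdft X j.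
Proof.
rewrite -{1}[X]tdftK ffunE; congr (_ *: _); apply: eq_bigr => j _.
by rewrite wave0 scale1r.
Qed.

End Fourier.

(** * Powers of a matrix whose eigenvalues lie in the open unit disc *)

Section PowersToZero.
Variable R : realType.

Lemma complex_geometric_lt (c z e : R[i]) : `|z| < 1 -> 0 < e ->
  \forall k \near \oo, `|c| * `|z| ^+ k < e.
Proof.
have /complex_realP[cr ->] := (normr_real c).
have /complex_realP[r rE] := (normr_real z).
move=> z1 e_gt0; have /complex_realP[er eE] := (gtr0_real e_gt0).
have r_ge0 : 0 <= r by rewrite -ler0c -rE.
have r1 : `|r| < 1 by rewrite ger0_norm// -ltcR -rE.
rewrite rE eE; rewrite eE ltcR in e_gt0.
have /(@cvgr0Pnorm_lt R R^o)/(_ _ e_gt0)[N _ geoN] := cvg_geometric cr r1.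
exists N => // k /geoN /=; rewrite -rmorphXn -rmorphM ltcR.
exact: le_lt_trans (ler_norm _).
Qed.

Lemma cvg0_lin_comb (I : finType) (c : I -> R[i]) (u : I -> nat -> R[i]) :
    (forall i, (u i k : R[i]^o) @[k --> \oo] --> (0 : R[i]^o)) ->
  (\sum_i c i * u i k : R[i]^o) @[k --> \oo] --> (0 : R[i]^o).
Proof.
move=> u0; elim: (index_enum I) => [|i s IHs].
  under eq_fun do rewrite big_nil.
  exact: (@cvg_cst R[i]^o).
under eq_fun do rewrite big_cons.
have cu0 : (c i * u i k : R[i]^o) @[k --> \oo] --> (0 : R[i]^o).
  have := @cvgMl_tmp R[i] nat \oo _ _ (c i) _ (u0 i).
  by rewrite mulr0; apply.
by have := cvgD cu0 IHs; rewrite addr0; apply.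
Qed.

(** After a rank [N] beyond which [`|b k| <= (1 - `|z|) * (e / 2)], one has
  [`|a (m + N)| <= `|a N| * `|z| ^+ m + e / 2]. *)
Lemma cvg0_affine_recursion (z : R[i]) (a b : nat -> R[i]) : `|z| < 1 ->
    (forall k, a k.+1 = z * a k + b k) ->
    (b k : R[i]^o) @[k --> \oo] --> (0 : R[i]^o) ->
  (a k : R[i]^o) @[k --> \oo] --> (0 : R[i]^o).
Proof.
move=> z1 aE /cvgr0Pnorm_lt b0; apply/cvgr0Pnorm_lt => e e_gt0.
have e2_gt0 : 0 < e / 2 by rewrite divr_gt0.
have d_gt0 : 0 < (1 - `|z|) * (e / 2) by rewrite mulr_gt0// subr_gt0.
have [N _ bN] := b0 _ d_gt0.
have aN m : `|a (m + N)%N| <= `|a N| * `|z| ^+ m + e / 2.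
  elim: m => [|m IHm]; first by rewrite mulr1 lerDl ltW.
  rewrite addSn aE; apply: le_trans (ler_normD _ _) _.
  rewrite normrM.
  apply: le_trans (lerD (ler_wpM2l (normr_ge0 z) IHm) (ltW (bN _ _))) _.
    exact: leq_addl.
  by rewrite exprS le_eqVlt; apply/orP; left; apply/eqP; ring.
have [K _ aK] := complex_geometric_lt (a N) z1 e2_gt0.
exists (K + N)%N => // k /= leKN_k.
have leN_k : (N <= k)%N by apply: leq_trans leKN_k; exact: leq_addl.
rewrite -(subnK leN_k); apply: le_lt_trans (aN _) _.
rewrite [ltRHS]splitr ltrD2r; apply: aK => /=.
by rewrite leq_subRL// addnC.
Qed.

(** Induction on the number of factors of the annihilating polynomial of [N]:
  [M * N - z *: N] is annihilated by one factor less. *)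
Lemma cvg0_mxpow_mul n (M N : 'M[R[i]]_n.+1) (r : seq R[i]) :
    (forall z, z \in r -> `|z| < 1) ->
    horner_mx M (\prod_(z <- r) ('X - z%:P)) * N = 0 ->
  forall i j, ((M ^+ k * N) i j : R[i]^o) @[k --> \oo] --> (0 : R[i]^o).
Proof.
elim: r N => [|z r IHr] N r1 MN0 i j.
  rewrite big_nil rmorph1 mul1r in MN0.
  by rewrite MN0; under eq_fun do rewrite mulr0 mxE; exact: cvg_cst.
have z1 : `|z| < 1 by apply: r1; rewrite mem_head.
pose N' := M * N - z *: N.
have cvgN' := IHr N' _ _ i j.
apply: (@cvg0_affine_recursion z _ (fun k => (M ^+ k * N') i j)) => //.
- move=> k; rewrite /N' mulrBr mulrA -exprSr -scalerAr.
  by move: (M ^+ _.+1 * N) (M ^+ k * N) => P Q; rewrite !mxE subrKC.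
- apply: cvgN' => [y y_r|]; first by apply: r1; rewrite inE y_r orbT.
  move: MN0; rewrite big_cons mulrC rmorphM -mulrA rmorphB /=.
  by rewrite horner_mx_X horner_mx_C mulrBl [z%:M * _]mul_scalar_mx.
Qed.

Lemma cvg0_mxpow n (M : 'M[R[i]]_n) :
    (forall z, eigenvalue M z -> `|z| < 1) ->
  forall i j, ((M ^+ k) i j : R[i]^o) @[k --> \oo] --> (0 : R[i]^o).
Proof.
case: n M => [|n] M M1 i j; first by case: i.
have [r char_r] := closed_field_poly_normal (char_poly M).
rewrite (monicP (char_poly_monic M)) scale1r in char_r.
under eq_fun do rewrite -[_ ^+ _]mulr1.
apply: (@cvg0_mxpow_mul _ _ _ r) => [z z_r|].
  by apply: M1; rewrite eigenvalue_root_char char_r root_prod_XsubC.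
by rewrite -char_r Cayley_Hamilton mul0r.
Qed.

End PowersToZero.

(** * Tubular eigenvalues and the order, in the Fourier domain *)

(** [eigenvalue] is defined by row vectors; this gives a column eigenvector. *)
Lemma eigenvalue_colP (F : fieldType) n (M : 'M[F]_n) (z : F) :
  eigenvalue M z -> exists2 x : 'cV_n, M *m x = z *: x & x != 0.
Proof.
rewrite /eigenvalue /eigenspace kermx_eq0 row_free_unit -unitmx_tr.
rewrite -row_free_unit -kermx_eq0 => /rowV0Pn[v /sub_kermxP vM0 v_neq0].
exists v^T; last by rewrite trmx_eq0.
apply/eqP; rewrite -subr_eq0 -mul_scalar_mx -mulmxBl.
by rewrite -[X in X *m _]trmxK -trmx_mul vM0 trmx0.
Qed.

Section TubularSpectrum.
Variables (R : realType) (p : nat).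
Implicit Types (j k : 'I_p.+1).

Lemma bcirc_tmul n m l (X : tensor R n m p.+1) (Y : tensor R m l p.+1) :
  bcirc (tmul X Y) = bcirc X *m bcirc Y.
Proof.
rewrite /bcirc mul_mxblock; apply: eq_mxblock => i k.
rewrite tmulE (reindex_inj (addIr (- k))); apply: eq_bigr => j _.
by rewrite opprB addrA subrK.
Qed.

Lemma bcirc0 n m : bcirc (0 : tensor R n m p.+1) = 0.
Proof. by apply/matrixP => i j; rewrite !mxE ffunE mxE. Qed.

Lemma bcirc_tid n : bcirc (tid R p n) = 1%:M.
Proof.
rewrite -mxdiagZ /mxdiag; apply: eq_mxblock => i j.
by rewrite ffunE subr_eq0 conform_mx_id.
Qed.

Lemma tnonsingularP (t : tensor R 1 1 p.+1) :
  tnonsingular t <-> forall j, tdft t j 0 0 != 0.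
Proof.
have mulE (x : tensor R 1 1 p.+1) i :
    tdft (tmul t x) i = tdft t i 0 0 *: tdft x i.
  by rewrite tdft_tmul [tdft t i in LHS]mx11_scalar mul_scalar_mx.
split=> [t_unit j|t_neq0]; last first.
  pose u := tidft (fun j => (tdft t j 0 0)^-1%:M : 'M[R[i]]_1).
  suff tu1 : tmul t u = tid R p 1.
    have /mulmx1_unit[]// : bcirc t *m bcirc u = 1%:M.
    by rewrite -bcirc_tmul tu1 bcirc_tid.
  apply: tdft_inj => j; rewrite mulE tidftK tdft_tid.
  by rewrite scale_scalar_mx mulfV.
apply/negP => /eqP tj0.
pose d := tidft (fun i => (i == j)%:R : 'M[R[i]]_1).
have td0 : tmul t d = 0.
  apply: tdft_inj => i; rewrite mulE tidftK tdft0.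
  by have [->|_] := eqVneq i j; rewrite ?tj0 ?scale0r ?scaler0.
have d0 : d = 0.
  apply: bcirc_inj; rewrite bcirc0 -[LHS](mulKmx t_unit) -bcirc_tmul td0.
  by rewrite bcirc0 mulmx0.
have: tdft d j = 0 by rewrite d0 tdft0.
by rewrite tidftK eqxx => /eqP; rewrite oner_eq0.
Qed.

Lemma sqnorm_col_neq0 n (x : 'cV[R[i]]_n) : ((x^t* *m x) 0 0 != 0) = (x != 0).
Proof.
have -> : (x^t* *m x) 0 0 = \sum_i `|x i 0| ^+ 2.
  by rewrite mxE; apply: eq_bigr => i _; rewrite !mxE mulrC -normCK.
congr (~~ _); rewrite psumr_eq0; last by move=> i _; rewrite exprn_ge0.
apply/allP/eqP => [x0|x0 i _]; last by rewrite x0 mxE normr0 expr0n /= eqxx.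
apply/matrixP => i j; rewrite (ord1 j) mxE.
by have := x0 i (mem_index_enum i); rewrite /= sqrf_eq0 normr_eq0 => /eqP.
Qed.

Lemma tubular_spectrumP n (A : tensor R n n p.+1) (lam : tensor R 1 1 p.+1) :
  tubular_spectrum A lam <->
  exists x : 'I_p.+1 -> 'cV[R[i]]_n, forall j,
    tdft A j *m x j = tdft lam j 0 0 *: x j /\ x j != 0.
Proof.
have hatE (X : tensor R n 1 p.+1) j :
    tdft (tmul X lam) j = tdft lam j 0 0 *: tdft X j.
  by rewrite tdft_tmul [tdft lam j in LHS]mx11_scalar mul_mx_scalar.
split=> [[X [AX /tnonsingularP X_neq0]]|[x xP]].
  exists (tdft X) => j; rewrite -hatE -tdft_tmul AX; split=> //.
  by have := X_neq0 j; rewrite tdft_tmul tdft_ctrans sqnorm_col_neq0.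
exists (tidft x); split.
  by apply: tdft_inj => j; rewrite hatE tdft_tmul !tidftK; have [] := xP j.
apply/tnonsingularP => j.
by rewrite tdft_tmul tdft_ctrans sqnorm_col_neq0 tidftK; have [] := xP j.
Qed.

(** Testing the quadratic form of a tubular tensor on the tensor whose
  transform is concentrated at [j] isolates its [j]-th Fourier component. *)
Lemma tdft_quad_form (A : tensor R 1 1 p.+1) j :
  exists2 X : tensor R 1 1 p.+1, X != 0 &
    tmul (tmul (ctrans X) A) X 0 0 0 = p.+1%:R^-1 * tdft A j 0 0.
Proof.
pose X := tidft (fun i => (i == j)%:R : 'M[R[i]]_1); exists X.
  apply/eqP => /(congr1 (fun Y => tdft Y j)); rewrite tidftK tdft0 eqxx.
  by move/eqP; rewrite oner_eq0.
rewrite slice0E mxE (bigD1 j)//= big1 => [|i /negPf ij].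
  rewrite !tdft_tmul tdft_ctrans tidftK eqxx addr0.
  by rewrite trmx1 map_mx1 mul1mx mulmx1.
by rewrite tdft_tmul tidftK ij mulmx0.
Qed.

Lemma tposdef_tdft (A : tensor R 1 1 p.+1) j : tposdef A -> 0 < tdft A j 0 0.
Proof.
have [X X_neq0 XAX] := tdft_quad_form A j.
by move=> /(_ X X_neq0); rewrite XAX pmulr_rgt0// invr_gt0 ltr0n.
Qed.

Lemma tpossemidef_tdft (A : tensor R 1 1 p.+1) j :
  tpossemidef A -> 0 <= tdft A j 0 0.
Proof.
have [X X_neq0 XAX] := tdft_quad_form A j.
by move=> /(_ X X_neq0); rewrite XAX pmulr_rge0// invr_gt0 ltr0n.
Qed.

(** The Fourier components of [t] are the eigenvalues of [circ t], in the order
  given by the columns of [dft]. *)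
Lemma circ_dft_tdft (t : tensor R 1 1 p.+1) (d : 'rV[R[i]]_p.+1) j :
  circ t = dft R p *m diag_mx d *m (dft R p)^t* -> tdft t j 0 0 = d 0 j.
Proof.
move=> tE; pose s : R[i] := (Num.sqrt p.+1%:R)^-1%:C%C.
have ss : s * s^* = p.+1%:R^-1.
  rewrite (conjc_real _ : s^* = s) -rmorphM -invfM -expr2 sqr_sqrtr ?ler0n//.
  by rewrite fmorphV rmorph_nat.
have -> : t = tidft (fun j => (d 0 j)%:M).
  apply/ffunP => k; rewrite ffunE; apply/matrixP => a b.
  (* The first column of circ t lists the entries of t. *)
  rewrite !ord1 !mxE summxE.
  have /matrixP/(_ k 0) := tE; rewrite mxE subr0 => ->.
  rewrite mxE mulr_sumr; apply: eq_bigr => l _.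
  rewrite mul_mx_diag !mxE mulr1n mul0n expr0 mulr1 -/s -ss.
  by rewrite waveC /wave; ring.
by rewrite tidftK mxE mulr1n.
Qed.

Lemma tsqrt_tdft (v w : tensor R 1 1 p.+1) j : is_tsqrt v w ->
  0 <= tdft w j 0 0 /\ tdft v j 0 0 = tdft w j 0 0 ^+ 2.
Proof.
case=> d [d_ge0 /circ_dft_tdft -> /circ_dft_tdft ->].
by rewrite !mxE ler0c sqrtr_ge0 -rmorphXn /= sqr_sqrtr.
Qed.

Lemma tdft_tube_delta j : tdft (tube (delta_mx 0 0 : 'cV[R[i]]_p.+1)) j = 1%:M.
Proof.
rewrite -(tdft_tid _ 1 j); congr (tdft _ j); apply/ffunP => k.
by rewrite !ffunE mxE andbT; case: (k == 0); rewrite ?raddf0.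
Qed.

Lemma tdft_gram (t : tensor R 1 1 p.+1) j :
  tdft (tmul (ctrans t) t) j 0 0 = `|tdft t j 0 0| ^+ 2.
Proof.
by rewrite tdft_tmul tdft_ctrans mxE big_ord1 !mxE mulrC -normCK.
Qed.

Lemma tdft_eigenvalue_lt1 n (A : tensor R n n p.+1) (rho : tensor R 1 1 p.+1) :
    is_tubular_spectral_radius A rho -> tlt rho (tube (delta_mx 0 0)) ->
  forall j z, eigenvalue (tdft A j) z -> `|z| < 1.
Proof.
move=> [mu [mu_spec mu_max rho_sqrt]] [_ _ rho_lt1] j z.
move=> /eigenvalue_colP[y Ay y_neq0].
have [x xP] := (tubular_spectrumP _ _).1 mu_spec.
(* lam is mu with its j-th Fourier component replaced by z. *)
pose lam : tensor R 1 1 p.+1 :=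
  tidft (fun i => (if i == j then z else tdft mu i 0 0)%:M).
have lamj : tdft lam j 0 0 = z by rewrite tidftK eqxx mxE mulr1n.
have lam_spec : tubular_spectrum A lam.
  apply/tubular_spectrumP; exists (fun i => if i == j then y else x i) => i.
  by rewrite tidftK mxE mulr1n; have [->|_] := eqVneq i j; [split | exact: xP].
have [_ _ /(tpossemidef_tdft j)] := mu_max _ lam_spec.
have [rhoj_ge0] := tsqrt_tdft j rho_sqrt.
have := tposdef_tdft j rho_lt1.
rewrite !tdftB tdft_tube_delta => rhoj_lt1 mu_rho.
rewrite mxE mu_rho [in X in _ + X]mxE tdft_gram lamj subr_ge0 => z_le.
have {}rhoj_lt1 : tdft rho j 0 0 < 1.
  by move: rhoj_lt1; rewrite !mxE subr_gt0.
rewrite -(@expr_lt1 _ 2)//; apply: le_lt_trans z_le _.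
by rewrite expr_lt1.
Qed.

End TubularSpectrum.

Theorem proposition3p3 (R : realType) (n p : nat) (A : tensor R n n p.+1)
    (rho : tensor R 1 1 p.+1) :
  is_tubular_spectral_radius A rho ->
  tlt rho (tube (delta_mx 0 0)) ->
  tensor_cvg (tpow A) 0.
Proof.
move=> rhoP rho_lt1 s a b.
have hat0 j := cvg0_mxpow (tdft_eigenvalue_lt1 rhoP rho_lt1 (j := j)) a b.
rewrite ffunE mxE.
under eq_fun => k.
  rewrite -[tpow A k]tdftK ffunE mxE summxE mulr_sumr.
  under eq_bigr => j _ do rewrite tdft_tpow mxE mulrA.
  over.
exact: cvg0_lin_comb.
Qed.
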